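(* We have $c_4\geq 3/7$. For every even integer $k\geq 4$ we have \[ c_k\geq\frac{1}{2}-\frac{1}{2k-2}, \] where the right-hand side is $\frac12-O(k^{-1})$.
   Context: Graphs are finite and simple. An induced path factor (IPF) of a graph $G$ is a set of induced paths in $G$ such that every vertex of $G$ is in exactly one of the paths; paths of any length are allowed, including trivial paths consisting of a single vertex. The induced path number $\rho(G)$ is the minimum number of paths in an IPF of $G$. For a fixed integer $k\geq 2$ and each $n$ for which a connected $k$-regular graph on $n$ vertices exists, let $\mathcal{M}_n$ be the maximum of $\rho(G)$ over all connected $k$-regular graphs $G$ on $n$ vertices. Define $c_k=\lim_{n\to\infty}\mathcal{M}_n/n$, the limit being taken over those $n$ for which such graphs exist (this limit exists for every $k\geq 2$). *)

(* Defs.v *)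
From HB Require Import structures.
From mathcomp Require Import all_boot all_order all_algebra.
From mathcomp Require Import all_classical all_reals all_analysis.

Set Implicit Arguments.
Unset Strict Implicit.
Unset Printing Implicit Defensive.

Import Order.TTheory GRing.Theory Num.Theory.
Import numFieldNormedType.Exports.

Local Open Scope classical_set_scope.
Local Open Scope ring_scope.

(** [edges] is the adjacency relation: every edge is stored in both
    orientations. *)
Record sgraph (V : finType) := SGraph {
  edges : {set V * V};
  _ : [forall x, forall y, ((x, y) \in edges) == ((y, x) \in edges)] &&
      [forall x, (x, x) \notin edges] }.

HB.instance Definition _ (V : finType) := [isSub for @edges V].
HB.instance Definition _ (V : finType) := [Finite of sgraph V by <:].

Definition adj (V : finType) (G : sgraph V) : rel V :=
  fun x y => (x, y) \in edges G.

Definition regular (V : finType) (G : sgraph V) (k : nat) : bool :=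
  [forall x, #|[set y | adj G x y]| == k].

Definition connected_graph (V : finType) (G : sgraph V) : bool :=
  [forall x, forall y, connect (adj G) x y].

(** [s] lists, in order, the vertices of an induced path: two of its vertices
    are adjacent in [G] exactly when they are consecutive in [s]. *)
Definition induced_path (V : finType) (G : sgraph V) (s : seq V) : bool :=
  [&& s != [::], uniq s &
      [forall x in s, forall y in s, adj G x y ==
         ((index x s).+1 == index y s) || ((index y s).+1 == index x s)]].

(** An induced path is determined, as a subgraph, by its vertex set, so a set of
    induced paths is represented by the set of their vertex sets. *)
Definition is_induced_path (V : finType) (G : sgraph V) (S : {set V}) : bool :=
  [exists t : #|S|.-tuple V, induced_path G t && (S == [set x in t]%SET)].

Definition is_ipf (V : finType) (G : sgraph V) (P : {set {set V}}) : bool :=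
  finset.partition P [set: V]%SET && [forall S in P, is_induced_path G S].

Lemma adj_irr (V : finType) (G : sgraph V) (x : V) : adj G x x = false.
Proof. by case: G => E p; apply/negbTE; have /andP[_ /forallP/(_ x)] := p. Qed.

Lemma ipf_exists (V : finType) (G : sgraph V) :
  exists m : nat, [exists P : {set {set V}}, is_ipf G P && (#|P| == m)].
Proof.
pose P : {set {set V}} := [set [set x] | x in V]%SET.
exists #|P|; apply/existsP; exists P; rewrite eqxx andbT; apply/andP; split.
  apply/and3P; split.
  - rewrite finset.eqEsubset finset.subsetT /=; apply/fintype.subsetP => x _.
    by apply/bigcupP; exists [set x]%SET; rewrite ?inE // imset_f.
  - apply/finset.trivIsetP => A B /imsetP[x _ ->] /imsetP[y _ ->] nxy.
    by rewrite disjoints1 inE; apply: contraNN nxy => /eqP ->.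
  - by apply/negP => /imsetP[x _ /finset.setP/(_ x)]; rewrite !inE eqxx.
apply/forallP => S; apply/implyP => /imsetP[x _ ->].
rewrite /is_induced_path cards1; apply/existsP; exists [tuple x].
apply/andP; split; last by apply/eqP/finset.setP => y; rewrite !inE.
apply/and3P; split => //.
apply/forallP => y; apply/implyP; rewrite inE => /eqP ->.
apply/forallP => z; apply/implyP; rewrite inE => /eqP ->.
by rewrite adj_irr /= eqxx.
Qed.

(** The induced path number. *)
Definition rho (V : finType) (G : sgraph V) : nat := ex_minn (ipf_exists G).

Definition connected_regular (k n : nat) (G : sgraph 'I_n) : bool :=
  connected_graph G && regular G k.

Definition max_rho (k n : nat) : nat :=
  \max_(G : sgraph 'I_n | connected_regular k G) rho G.

(** The limit is taken along the orders [n] of connected [k]-regular graphs. *)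
Definition c (R : realType) (k : nat) : R :=
  lim ((fun n : nat => (max_rho k n)%:R / n%:R : R) @
       within [set n | exists G : sgraph 'I_n, connected_regular k G] \oo).

(* Main.v *)
Require Import Defs.
From mathcomp Require Import all_boot all_order all_algebra.
From mathcomp Require Import all_classical all_reals all_analysis.
From mathcomp Require Import fintype finset zify ring lra.

(** Let [k] be even. Deleting an edge from each of two connected [k]-regular
    graphs and joining the four ends crosswise gives a connected [k]-regular
    graph, since a graph with even degrees has no bridge; the induced path
    numbers add up to within a constant. By Fekete's argument [c k] therefore
    exists and is at least the limit of [rho G / n] along any family.

    The family is a sun (a cycle of [d_i]'s, each of its edges [d_i d_(i+1)]
    completed to a triangle by a vertex [a_i]) in which copies of [K_(k+1)] minus
    an edge are attached to the core vertices by the two ends of the missing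
    edge, so as to bring all degrees to [k]. An induced path factor has as many
    paths as there are vertices minus edges used. It uses at most one edge of
    each triangle and at most [(k+2)/2] edges in each pendant together with its
    centre. With [k = 2r+4] this yields the density
    [(1 + (2r+1)(r+2)) / (2 + (2r+1)(2r+5))], which is [3/7] for [r = 0] and at
    least [(k-2)/(2k-2)] for all [r]. *)

Set Implicit Arguments.
Unset Strict Implicit.
Unset Printing Implicit Defensive.

(** * Induced path factors as block maps *)

Section SGraph.

Variable V : finType.
Implicit Types (G : sgraph V) (S : {set V}) (f : V -> {set V}).

Lemma adj_sym G : symmetric (adj G).
Proof.
by move=> x y; case: G => E p; have /andP[/forallP/(_ x)/forallP/(_ y)/eqP] := p.
Qed.

Fact build_graph_subproof (r : rel V) (sym_r : symmetric r)
    (irr_r : irreflexive r) (E := [set p : V * V | r p.1 p.2]) :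
  [forall x, forall y, ((x, y) \in E) == ((y, x) \in E)] &&
  [forall x, (x, x) \notin E].
Proof.
apply/andP; split; apply/forallP => x; last by rewrite inE irr_r.
by apply/forallP => y; rewrite !inE /= sym_r.
Qed.

Definition build_graph (r : rel V) (sym_r : symmetric r)
    (irr_r : irreflexive r) : sgraph V :=
  SGraph (build_graph_subproof sym_r irr_r).

Lemma adj_build (r : rel V) (sym_r : symmetric r) (irr_r : irreflexive r) :
  adj (build_graph sym_r irr_r) =2 r.
Proof. by move=> x y; rewrite /adj inE. Qed.

Lemma regularP G k :
  reflect (forall x, \sum_y adj G x y = k) (regular G k).
Proof.
have card x : \sum_y adj G x y = #|[set y | adj G x y]%classic|.
  rewrite -sum1_card [in RHS]big_mkcond; apply: eq_bigr => y _.
  by rewrite unfold_in /in_set asboolb; case: adj.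
by apply: (iffP forallP) => [h x|h x]; [rewrite card; apply/eqP | rewrite -card h].
Qed.

Lemma is_induced_pathP G S :
  reflect (exists2 s, induced_path G s & S = [set x in s])
          (is_induced_path G S).
Proof.
apply: (iffP existsP) => [[t /andP[tp /eqP St]]|[s sp St]]; first by exists t.
have us : uniq s by have /and3P[] := sp.
have ss : size s == #|S| by rewrite St cardsE (card_uniqP us).
by exists (Tuple ss); rewrite /= sp -St eqxx.
Qed.

Lemma induced_pathP G s :
  reflect [/\ s != [::], uniq s & {in s &, forall x y, adj G x y =
            ((index x s).+1 == index y s) || ((index y s).+1 == index x s)}]
          (induced_path G s).
Proof.
apply: (iffP and3P) => -[s0 us h]; split=> //.
  by move=> x y xs ys; have /forall_inP/(_ x xs)/forall_inP/(_ y ys)/eqP := h.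
by apply/forall_inP => x xs; apply/forall_inP => y ys; rewrite h.
Qed.

Lemma induced_path_catl G s1 s2 :
  s1 != [::] -> induced_path G (s1 ++ s2) -> induced_path G s1.
Proof.
move=> s0 /induced_pathP[_ us h]; apply/induced_pathP; split=> //.
  by move: us; rewrite cat_uniq => /and3P[].
by move=> x y xs ys; rewrite h ?mem_cat ?xs ?ys // !index_cat xs ys.
Qed.

Lemma induced_path_catr G s1 s2 :
  s2 != [::] -> induced_path G (s1 ++ s2) -> induced_path G s2.
Proof.
move=> s0 /induced_pathP[_ us h]; apply/induced_pathP.
move: us; rewrite cat_uniq => /and3P[_ /hasPn dis us].
split=> // x y xs ys; rewrite h ?mem_cat ?xs ?ys ?orbT // !index_cat.
by rewrite (negbTE (dis _ xs)) (negbTE (dis _ ys)) -!addnS !eqn_add2l.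
Qed.

Lemma induced_path_path G x s : induced_path G (x :: s) -> path (adj G) x s.
Proof.
move=> /induced_pathP[_ us h]; apply/(pathP x) => i i_s.
have m1 : nth x (x :: s) i \in x :: s by rewrite mem_nth //= ltnW.
have m2 : nth x (x :: s) i.+1 \in x :: s by rewrite mem_nth.
by rewrite -[nth x s i]/(nth x (x :: s) i.+1) h // !index_uniq ?eqxx //= ltnW.
Qed.

Lemma is_induced_path1 G x : is_induced_path G [set x].
Proof.
apply/is_induced_pathP; exists [:: x]; last by apply/setP => y; rewrite !inE.
apply/induced_pathP; split=> // y z; rewrite !inE => /eqP-> /eqP->.
by rewrite adj_irr /= eqxx.
Qed.

(** The height is the position in the list of the path. Adjacency inside [S] becomes a difference of
    one in height, so forbidden subgraphs and edge counts reduce to arithmetic. *)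
Lemma induced_path_height G S : is_induced_path G S ->
  exists h : V -> nat,
    [/\ {in S &, injective h},
        {in S &, forall x y, adj G x y = ((h x).+1 == h y) || ((h y).+1 == h x)}
      & forall x, x \in S -> 0 < h x -> exists2 y, y \in S & (h y).+1 = h x].
Proof.
move=> /is_induced_pathP[s /induced_pathP[s0 us h] ->].
exists (index^~ s); split.
- by move=> x y; rewrite !inE => xs ys /(congr1 (nth x s)); rewrite !nth_index.
- by move=> x y; rewrite !inE; exact: h.
move=> x; rewrite inE => xs i0; exists (nth x s (index x s).-1).
  by rewrite inE mem_nth // prednK // ltnW // index_mem.
by rewrite index_uniq // prednK // ltnW // index_mem.
Qed.

(** Three heights cannot pairwise differ by exactly one: the parities clash. *)
Lemma induced_path_triangle_free G S x y z : is_induced_path G S ->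
  x \in S -> y \in S -> z \in S -> adj G x y -> adj G y z -> adj G x z -> False.
Proof.
move=> /induced_path_height[h [_ hadj _]] xS yS zS; rewrite !hadj //; lia.
Qed.

(** If [x] and [z] have different heights, these differ by two, and [y] and [t] both sit at the
    height halfway. *)
Lemma induced_path_C4_free G S x y z t : is_induced_path G S ->
  x \in S -> y \in S -> z \in S -> t \in S ->
  adj G x y -> adj G y z -> adj G z t -> adj G t x -> x = z \/ y = t.
Proof.
move=> /induced_path_height[h [hinj hadj _]] xS yS zS tS; rewrite !hadj // => *.
by case: (h x =P h z) => [/hinj|] e; [left; apply: e | right; apply: hinj; lia].
Qed.

(** Every vertex of positive height contributes the edge to its predecessor, and at most one vertex
    has height 0. The double sum counts each edge twice. *)
Lemma induced_path_edges G S : is_induced_path G S ->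
  2 * #|S| <= (\sum_(x in S) \sum_(y in S) adj G x y) + 2.
Proof.
move=> /induced_path_height[h [hinj hadj hpred]].
have -> : \sum_(x in S) \sum_(y in S) adj G x y =
    2 * \sum_(x in S) \sum_(y in S) ((h y).+1 == h x).
  rewrite mul2n -addnn [X in _ = X + _]exchange_big -big_split /=.
  apply: eq_bigr => x xS; rewrite -big_split /=; apply: eq_bigr => y yS.
  by rewrite hadj //; lia.
have le1 : \sum_(x in S) (h x > 0) <=
    \sum_(x in S) \sum_(y in S) ((h y).+1 == h x).
  apply: leq_sum => x xS; case: (posnP (h x)) => // /(hpred _ xS)[y yS e].
  by rewrite (bigD1 y) //= e eqxx.
have le2 : \sum_(x in S) (h x == 0) <= 1.
  have [x /andP[xS hx]|no] := pickP [pred x in S | h x == 0]; last first.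
    by rewrite big1 // => x xS; have := no x; rewrite inE xS /= => ->.
  rewrite (bigD1 x) //= hx big1 // => y /andP[yS nyx].
  apply/eqP; rewrite eqb0; apply: contraNN nyx => /eqP hy.
  by apply/eqP/hinj => //; rewrite hy (eqP hx).
have : #|S| = \sum_(x in S) (h x > 0) + \sum_(x in S) (h x == 0).
  by rewrite -sum1_card -big_split; apply: eq_bigr => x _ /=; case: (h x).
lia.
Qed.

(** [f] sends a vertex to the vertex set of its path in an IPF. *)
Definition path_blocks G f :=
  [/\ forall z, z \in f z, forall y z, y \in f z -> f y = f z
    & forall z, is_induced_path G (f z)].

Lemma rho_le_blocks G f : path_blocks G f -> rho G <= #|[set f z | z in V]|.
Proof.
move=> [fz fyz fpath]; rewrite /rho; case: ex_minnP => m _; apply.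
apply/existsP; exists [set f z | z in V]; rewrite eqxx andbT; apply/andP; split.
  apply/and3P; split.
  - rewrite eqEsubset subsetT /=; apply/fintype.subsetP => z _.
    by apply/bigcupP; exists (f z); rewrite ?imset_f.
  - apply/trivIsetP => A B /imsetP[x _ ->] /imsetP[y _ ->]; apply: contraNT.
    by move=> /pred0Pn[z /andP[/= /fyz <- /fyz <-]].
  - by apply/negP => /imsetP[x _ /setP/(_ x)]; rewrite fz inE.
by apply/forall_inP => S /imsetP[x _ ->].
Qed.

Lemma rho_blocks G :
  exists2 f, path_blocks G f & #|[set f z | z in V]| <= rho G.
Proof.
rewrite /rho; case: ex_minnP => m /existsP[P /andP[/andP[partP pathP] /eqP <-]] _.
have [/eqP cov tri _] := and3P partP.
have inP x : pblock P x \in P by rewrite pblock_mem // cov inE.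
exists (pblock P); last by apply/subset_leq_card/fintype.subsetP => S /imsetP[x _ ->].
split.
- by move=> z; rewrite mem_pblock cov inE.
- by move=> y z /(same_pblock tri).
- by move=> z; apply: (forall_inP pathP).
Qed.

(* Cutting a path at [v] leaves [{v}] and at most two subpaths. *)
Lemma isolate_vertex G f v : path_blocks G f ->
  exists f', [/\ path_blocks G f', f' v = [set v],
    forall w, f w = [set w] -> f' w = [set w] &
    #|[set f' z | z in V]| <= #|[set f z | z in V]| + 3].
Proof.
move=> [fz fyz fpath].
have /is_induced_pathP[s sp fvs] := fpath v.
have : v \in s by have := fz v; rewrite fvs inE.
move=> /path.splitPr sE; case: sE sp fvs => t1 t2 sp fvs.
have /induced_pathP[_ us _] := sp.
have vt1 : v \notin t1.
  by apply/negP => vt; move: us; rewrite cat_uniq /= vt andbF.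
have vt2 : v \notin t2 by move: us; rewrite cat_uniq /= => /and4P[_ _ ->].
have dis x : x \in t1 -> x \in t2 -> False.
  by move: us; rewrite cat_uniq /= => /and3P[_ /norP[_ /hasPn h] _] xt1 /h /negP.
have infv x : (x \in f v) = [|| x == v, x \in t1 | x \in t2].
  by rewrite fvs inE mem_cat inE orbCA.
pose f' z := if z == v then [set v] else
  if z \in t1 then [set x in t1] else if z \in t2 then [set x in t2] else f z.
have f'v : f' v = [set v] by rewrite /f' eqxx.
have f'1 x : x \in t1 -> f' x = [set x in t1].
  by move=> xt; rewrite /f' xt; case: eqP xt => // ->; rewrite (negPf vt1).
have f'2 x : x \in t2 -> f' x = [set x in t2].
  move=> xt; rewrite /f' xt; case: eqP xt => [->|_ xt]; first by rewrite (negPf vt2).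
  by case: ifP => // /dis/(_ xt).
have f'3 x : x \notin f v -> f' x = f x.
  by rewrite infv /f' => /norP[/negPf-> /norP[/negPf-> /negPf->]].
exists f'; split => //.
- split.
  + move=> z; have [|/f'3->//] := boolP (z \in f v).
    rewrite infv => /or3P[/eqP->|zt|zt]; first by rewrite f'v inE.
      by rewrite f'1 // inE.
    by rewrite f'2 // inE.
  + move=> y z; have [|zv] := boolP (z \in f v); last first.
      rewrite f'3 // => yz; rewrite f'3 ?(fyz _ _ yz) //.
      apply: contraNN zv => yv; rewrite -(fyz _ _ yv) (fyz _ _ yz); exact: fz.
    rewrite infv => /or3P[/eqP->|zt|zt].
    * by rewrite f'v inE => /eqP->.
    * by rewrite f'1 // inE => yt; rewrite f'1.
    * by rewrite f'2 // inE => yt; rewrite f'2.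
  + move=> z; have [|/f'3->//] := boolP (z \in f v).
    rewrite infv => /or3P[/eqP->|zt|zt].
    * by rewrite f'v is_induced_path1.
    * rewrite f'1 //; apply/is_induced_pathP; exists t1 => //.
      by apply: (induced_path_catl _ sp); case: (t1) zt.
    * rewrite f'2 //; apply/is_induced_pathP; exists t2 => //.
      rewrite -cat_rcons in sp.
      by apply: (induced_path_catr _ sp); case: (t2) zt.
- move=> w fw; have [wv|/f'3->//] := boolP (w \in f v).
  suff -> : w = v by [].
  by have := fz v; rewrite -(fyz _ _ wv) fw inE => /eqP.
(* An empty [t1] or [t2] gives the empty set, which is no block; an upper bound on the set of blocks
   suffices. *)
- have sub : [set f' z | z in V] \subset
      [set f z | z in V] :|: [set [set v]; [set x in t1]; [set x in t2]].
    apply/fintype.subsetP => S /imsetP[x _ ->]; rewrite inE.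
    have [|/f'3->] := boolP (x \in f v); last by rewrite imset_f.
    by rewrite infv => /or3P[/eqP->|/f'1->|/f'2->]; rewrite ?f'v !inE eqxx !orbT.
  apply: leq_trans (subset_leq_card sub) _; apply: leq_trans (leq_card_setU _ _) _.
  rewrite leq_add2l; apply: leq_trans (leq_card_setU _ _) _.
  by rewrite cards1 addn1 ltnS cards2; case: (_ != _).
Qed.

End SGraph.

(** * Comparing the induced path numbers of two graphs *)

Lemma path_const (T : eqType) (e : rel T) (P : pred T) x s :
    path e x s ->
    {in x :: s &, forall y z, e y z -> P y = P z} ->
  {in x :: s, forall y, P y = P x}.
Proof.
elim: s x => [|y s IH] x /=; first by move=> _ _ y; rewrite inE => /eqP->.
move=> /andP[exy ps] h z; rewrite inE => /predU1P[->//|zs].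
have -> : P x = P y by apply: h; rewrite ?inE ?eqxx ?orbT.
by apply: IH zs => // u v us vs; apply: h; rewrite inE ?us ?vs orbT.
Qed.

Lemma subset_codom_map (T : finType) (U : eqType) (g : T -> U) t :
  {subset t <= codom g} -> exists s, t = map g s.
Proof.
elim: t => [|x t IH] sub; first by exists [::].
have /codomP[y ->] := sub x (mem_head _ _).
have [s ->] : exists s, t = map g s.
  by apply: IH => z zt; apply: sub; rewrite inE zt orbT.
by exists (y :: s).
Qed.

Lemma induced_path_map (V W : finType) (F : sgraph V) (G : sgraph W)
    (g : W -> V) s : injective g ->
    {in s &, forall a b, adj F (g a) (g b) = adj G a b} ->
  induced_path F (map g s) -> induced_path G s.
Proof.
move=> ginj gadj /induced_pathP[s0 us h]; apply/induced_pathP; split.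
- by case: (s) s0.
- by rewrite map_inj_uniq in us.
- by move=> x y xs ys; rewrite -gadj // h ?map_f // !index_map.
Qed.

(* [D] collects the vertices near which [G] and [F] may differ; they have to be
   isolated in the factor of [F]. *)
Lemma rho_restrict (V W : finType) (F : sgraph V) (G : sgraph W) (g : W -> V)
    (D : {set W}) (f : V -> {set V}) :
    injective g ->
    (forall a b, a \notin D -> b \notin D -> adj F (g a) (g b) = adj G a b) ->
    (forall a z, a \notin D -> adj F (g a) z -> z \in codom g) ->
    path_blocks F f ->
    {in D, forall d, f (g d) = [set g d]} ->
  rho G <= #|[set f (g z) | z in W]|.
Proof.
move=> ginj gadj gclosed [fz fyz fpath] fD.
pose f1 z := g @^-1: f (g z).
have f1_blocks : path_blocks G f1.
  split.
  - by move=> z; rewrite inE.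
  - by move=> y z; rewrite inE /f1 => /fyz ->.
  move=> z; have [zD|zD] := boolP (z \in D).
    suff -> : f1 z = [set z] by apply: is_induced_path1.
    by apply/setP => y; rewrite !inE fD // inE (inj_eq ginj).
  have fzD d : g d \in f (g z) -> d \notin D.
    move=> dz; apply: contra zD => dD.
    have := fz (g z); rewrite -(fyz _ _ dz) fD // inE (inj_eq ginj).
    by move=> /eqP->.
  have /is_induced_pathP[t tp ft] := fpath (g z).
  have {}fzD d : g d \in t -> d \notin D by move=> dt; apply: fzD; rewrite ft inE.
  (* Away from [D] no edge leaves the image of [g]; the path avoids [D] and contains [g z], so it
     stays in the image and can be pulled back. *)
  have /subset_codom_map[s ts] : {subset t <= codom g}.
    have zt : g z \in t by have := fz (g z); rewrite ft inE.
    case: t tp zt fzD {ft} => // x t tp zt fzD.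
    have cst : {in x :: t, forall y, (y \in codom g) = (x \in codom g)}.
      apply: (path_const (induced_path_path tp)) => y y' yt yt' yy'.
      apply/idP/idP => /codomP[a ea].
        by apply: (gclosed a); rewrite ?fzD -?ea.
      by apply: (gclosed a); rewrite ?fzD -?ea // adj_sym.
    by move=> y /cst->; rewrite -(cst _ zt) codom_f.
  apply/is_induced_pathP; exists s.
    apply: (induced_path_map ginj (F := F)); last by rewrite -ts.
    by move=> a b aS bS; apply: gadj; apply: fzD; rewrite ts map_f.
  by apply/setP => y; rewrite !inE ft ts inE mem_map.
apply: leq_trans (rho_le_blocks f1_blocks) _.
have -> : [set f1 z | z in W] =
    [set g @^-1: S | S : {set V} in [set f (g z) | z in W]].
  by rewrite -imset_comp.
exact: leq_imset_card.
Qed.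

Lemma rho_iso (V W : finType) (F : sgraph V) (G : sgraph W) (g : W -> V) :
  bijective g -> (forall a b, adj F (g a) (g b) = adj G a b) -> rho G <= rho F.
Proof.
move=> [g' gK g'K] gadj; have [f fp le] := rho_blocks F; apply: leq_trans le.
have := @rho_restrict _ _ F G g set0 f (can_inj gK).
move=> /(_ (fun a b _ _ => gadj a b))/(_ _ fp) h.
apply: leq_trans (h _ _) _.
- by move=> a z _ _; rewrite -(g'K z) codom_f.
- by move=> d; rewrite inE.
by apply/subset_leq_card/fintype.subsetP => S /imsetP[x _ ->]; rewrite imset_f.
Qed.

(** [max_rho] only ranges over graphs on ordinals, so the graph is transported along the enumeration
    of [V]. *)
Lemma rho_le_max_rho (V : finType) (G : sgraph V) k n : #|V| = n ->
    connected_graph G -> regular G k ->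
  rho G <= max_rho k n /\ exists G' : sgraph 'I_n, connected_regular k G'.
Proof.
move=> <- {n} conG regG.
have sym : symmetric (fun i j : 'I_#|V| => adj G (enum_val i) (enum_val j)).
  by move=> i j; rewrite adj_sym.
have irr : irreflexive (fun i j : 'I_#|V| => adj G (enum_val i) (enum_val j)).
  by move=> i; rewrite adj_irr.
pose G' := build_graph sym irr.
have adjG' x y : adj G' (enum_rank x) (enum_rank y) = adj G x y.
  by rewrite adj_build !enum_rankK.
have regG' : regular G' k.
  apply/regularP => i; rewrite -(enum_valK i) (reindex enum_rank) /=; last first.
    by apply: onW_bij; apply: enum_rank_bij.
  by under eq_bigr do rewrite adjG'; apply/regularP.
have conG' : connected_graph G'.
  apply/forallP => i; apply/forallP => j; rewrite -(enum_valK i) -(enum_valK j).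
  have /forallP/(_ (enum_val i))/forallP/(_ (enum_val j)) := conG.
  move=> /connectP[p pp ->]; apply/connectP; exists (map enum_rank p).
    by rewrite path_map; apply: sub_path pp => x y /=; rewrite adjG'.
  by rewrite last_map.
have cr : connected_regular k G' by rewrite /connected_regular conG'.
split; last by exists G'.
apply: leq_trans (rho_iso (enum_rank_bij V) adjG') _.
exact: (@leq_bigmax_cond _ _ (fun G => rho G) G').
Qed.

Lemma rho_le_card (V : finType) (G : sgraph V) : rho G <= #|V|.
Proof.
pose f z : {set V} := [set z].
have fp : path_blocks G f.
  split=> [z|y z|z]; rewrite ?inE //; first by move/eqP->.
  exact: is_induced_path1.
by apply: leq_trans (rho_le_blocks fp) (leq_imset_card _ _).
Qed.

Lemma max_rho_le k n : max_rho k n <= n.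
Proof. by apply/bigmax_leqP => G _; rewrite -[leqRHS]card_ord rho_le_card. Qed.

Lemma max_rho_witness k n : (exists G : sgraph 'I_n, connected_regular k G) ->
  exists2 G : sgraph 'I_n, connected_regular k G & rho G = max_rho k n.
Proof.
move=> [G0 G0c]; rewrite /max_rho (bigmax_eq_arg G0) //.
by case: arg_maxnP => // G Gc _; exists G.
Qed.

(** Each related pair is counted together with its reversal. The relation is arbitrary because it
    will be a component of a graph in one place and a matching inside a clique in another. *)
Lemma handshake (T : finType) (r : rel T) : symmetric r -> irreflexive r ->
  ~~ odd (\sum_x \sum_y r x y).
Proof.
move=> sym irr.
have -> : \sum_x \sum_y r x y =
    (\sum_x \sum_y (r x y && (enum_rank x < enum_rank y))).*2.
  rewrite -addnn [X in _ = X + _]exchange_big -big_split; apply: eq_bigr => x _ /=.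
  rewrite -big_split; apply: eq_bigr => y _ /=; rewrite (sym y).
  have [<-|nxy] := eqVneq x y; first by rewrite irr.
  have : enum_rank x != enum_rank y by rewrite (inj_eq enum_rank_inj).
  by rewrite -val_eqE /=; case: ltngtP => //; case: (r x y).
by rewrite odd_double.
Qed.

Lemma connect_graph_sym (V : finType) (G : sgraph V) : connect_sym (adj G).
Proof. exact/sym_connect_sym/adj_sym. Qed.

(** * Superadditivity of the maximal induced path number *)

(** A graph with all degrees even has no bridge, so [v] stays reachable from [u] and every use of
    the deleted edge can be rerouted. *)
Lemma connect_del_edge (V : finType) (G : sgraph V) k (u v : V) (r : rel V) :
    connected_graph G -> regular G k -> ~~ odd k -> adj G u v ->
    (forall x y, r x y = adj G x y &&
       ~~ (((x == u) && (y == v)) || ((x == v) && (y == u)))) ->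
  forall x y, connect r x y.
Proof.
move=> conG /regularP regG evk uv rE.
have sym : symmetric r.
  by move=> x y; rewrite !rE adj_sym orbC (andbC (x == u)) (andbC (x == v)).
have csym : connect_sym r := sym_connect_sym sym.
have irr : irreflexive r by move=> x; rewrite rE adj_irr.
have nuv : u != v by apply: contraTneq uv => ->; rewrite adj_irr.
have ruv : connect r u v.
  (* Otherwise the degrees in the component of [u] have odd sum [k|A| - 1]. *)
  apply/negP => /negP nc.
  pose A x := connect r u x.
  pose s x y := [&& A x, A y & r x y].
  have : ~~ odd (\sum_x \sum_y s x y).
    apply: handshake => [x y|x]; last by rewrite /s irr !andbF.
    by rewrite /s sym andbCA.
  (* Since [v] lies outside the component, [u] is its only vertex that has lost a neighbour. *)
  have -> : \sum_x \sum_y s x y = \sum_(x | A x) (k - (x == u)).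
    rewrite [RHS]big_mkcond; apply: eq_bigr => x _ /=.
    have [Ax|nAx] := boolP (A x); last first.
      by rewrite big1 // => y _; rewrite /s (negPf nAx).
    have nxv : x == v = false by apply: contraNF nc => /eqP<-.
    rewrite -(regG x).
    have -> : \sum_y adj G x y = \sum_y s x y + (x == u).
      have -> : (x == u) = \sum_y ((x == u) && (y == v)) :> nat.
        rewrite (bigD1 v) //= eqxx andbT big1 ?addn0 // => y /negPf->.
        by rewrite andbF.
      rewrite -big_split /=; apply: eq_bigr => y _.
      have -> : s x y = r x y.
        rewrite /s Ax /=; case rxy: (r x y); rewrite ?andbF // andbT.
        exact: connect_trans Ax (connect1 rxy).
      rewrite rE nxv /= orbF; have [exu|] := eqVneq x u; last by rewrite andbT addn0.
      have [eyv|] := eqVneq y v; last by rewrite andbT addn0.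
      by rewrite exu eyv uv.
    by rewrite addnK.
  have Au : A u by apply: connect0.
  have k0 : 0 < k by rewrite -(regG u) (bigD1 v) //= uv.
  rewrite (bigD1 u) //= eqxx.
  under eq_bigr => x /andP[_ /negPf->] do rewrite subn0.
  by rewrite sum_nat_const oddD oddM (negPf evk) andbF addbF subn1 -subn1 oddB ?(negPf evk).
move=> x y; have /forallP/(_ x)/forallP/(_ y) := conG.
apply: connect_sub => a b ab.
case rab: (r a b); first exact: connect1.
move: rab; rewrite rE ab /= => /negbFE /orP[] /andP[/eqP-> /eqP->] //.
by rewrite csym.
Qed.

(** * Crosswise gluing of two regular graphs *)

Section Glue.

Variables (V1 V2 : finType) (G1 : sgraph V1) (G2 : sgraph V2).
Variables (u v : V1) (x y : V2).

Definition glue_rel (p q : V1 + V2) : bool :=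
  match p, q with
  | inl a, inl b => adj G1 a b &&
      ~~ (((a == u) && (b == v)) || ((a == v) && (b == u)))
  | inr a, inr b => adj G2 a b &&
      ~~ (((a == x) && (b == y)) || ((a == y) && (b == x)))
  | inl a, inr b | inr b, inl a =>
      ((a == u) && (b == x)) || ((a == v) && (b == y))
  end.

Fact glue_sym : symmetric glue_rel.
Proof.
move=> [a|a] [b|b] //=; rewrite adj_sym orbC; first by rewrite !(andbC (_ == v)).
by rewrite !(andbC (_ == y)).
Qed.

Fact glue_irr : irreflexive glue_rel.
Proof. by move=> [a|a] /=; rewrite adj_irr. Qed.

Definition glue : sgraph (V1 + V2)%type := build_graph glue_sym glue_irr.

Hypotheses (uv : adj G1 u v) (xy : adj G2 x y).

Let nuv : u == v = false.
Proof. by apply: contraTF uv => /eqP->; rewrite adj_irr. Qed.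

Let nxy : x == y = false.
Proof. by apply: contraTF xy => /eqP->; rewrite adj_irr. Qed.

Let sum_pair (T : finType) (p q : bool) (c d : T) : p && q = false -> c != d ->
  \sum_z ((p && (z == c)) || (q && (z == d))) = p + q.
Proof.
move=> pq cd; have dc : d == c = false by rewrite eq_sym (negPf cd).
rewrite (bigD1 c) //= (bigD1 d) ?dc //= big1 ?addn0; last first.
  by move=> z /andP[/negPf-> /negPf->]; rewrite !andbF.
by rewrite !eqxx (negPf cd) !andbF /= orbF !andbT.
Qed.

Lemma glue_regular k : regular G1 k -> regular G2 k -> regular glue k.
Proof.
move=> /regularP reg1 /regularP reg2; apply/regularP => p.
under eq_bigr do rewrite adj_build.
rewrite big_sumType /=; case: p => a /=.
- rewrite (@sum_pair _ (a == u) (a == v) x y) ?nxy //; last first.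
    by case: eqP => // ->; rewrite nuv.
  (* The same count with targets [v] and [u] gives the deleted edges at [a], which therefore balance
     the new ones. *)
  have <- := @sum_pair _ (a == u) (a == v) v u; rewrite 1?(eq_sym v u) ?nuv //; last first.
    by case: eqP => // ->; rewrite nuv.
  rewrite -big_split -(reg1 a); apply: eq_bigr => b _ /=.
  case: orP => [[] /andP[/eqP-> /eqP->]|]; rewrite ?andbF ?andbT ?addn0 //= ?uv //.
  by rewrite adj_sym uv.
- rewrite (eq_bigr (fun i => ((a == x) && (i == u)) || ((a == y) && (i == v)) : nat)); last first.
    by move=> i _; rewrite andbC [X in _ || X]andbC.
  rewrite (@sum_pair _ (a == x) (a == y) u v) ?nuv //; last first.
    by case: eqP => // ->; rewrite nxy.
  have <- := @sum_pair _ (a == x) (a == y) y x; rewrite 1?(eq_sym y x) ?nxy //; last first.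
    by case: eqP => // ->; rewrite nxy.
  rewrite addnC -big_split -(reg2 a); apply: eq_bigr => b _ /=.
  case: orP => [[] /andP[/eqP-> /eqP->]|]; rewrite ?andbF ?andbT ?addn0 //= ?xy //.
  by rewrite adj_sym xy.
Qed.

(** Deleting one edge leaves each side connected because the degrees are even; the edge from [u] to
    [x] then links the sides. *)
Lemma glue_connected k : ~~ odd k -> regular G1 k -> regular G2 k ->
  connected_graph G1 -> connected_graph G2 -> connected_graph glue.
Proof.
move=> evk reg1 reg2 con1 con2.
have c1 a b : connect (adj glue) (inl a) (inl b).
  have /connectP[p pp ->] := connect_del_edge con1 reg1 evk uv (fun _ _ => erefl) a b.
  apply/connectP; exists (map inl p); last by rewrite last_map.
  by rewrite path_map; apply: sub_path pp => s t /=; rewrite adj_build.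
have c2 a b : connect (adj glue) (inr a) (inr b).
  have /connectP[p pp ->] := connect_del_edge con2 reg2 evk xy (fun _ _ => erefl) a b.
  apply/connectP; exists (map inr p); last by rewrite last_map.
  by rewrite path_map; apply: sub_path pp => s t /=; rewrite adj_build.
have c12 a b : connect (adj glue) (inl a) (inr b).
  apply: connect_trans (c1 a u) (connect_trans _ (c2 x b)).
  by apply: connect1; rewrite adj_build /= !eqxx.
apply/forallP => -[a|a]; apply/forallP => -[b|b] //.
by rewrite connect_graph_sym.
Qed.

(* Each of the four isolated ends costs at most three blocks. *)
Lemma rho_glue : rho G1 + rho G2 <= rho glue + 12.
Proof.
have [f0 p0 le0] := rho_blocks glue.
have [f1 [p1 e1 _ le1]] := isolate_vertex (inl u) p0.
have [f2 [p2 e2 k2 le2]] := isolate_vertex (inl v) p1.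
have [f3 [p3 e3 k3 le3]] := isolate_vertex (inr x) p2.
have [f [p e4 k4 le4]] := isolate_vertex (inr y) p3.
have le : #|[set f z | z : V1 + V2]| <= rho glue + 12.
  rewrite -[12]/(3 + 3 + 3 + 3) !addnA.
  apply: leq_trans le4 _; rewrite leq_add2r; apply: leq_trans le3 _.
  rewrite leq_add2r; apply: leq_trans le2 _; rewrite leq_add2r.
  by apply: leq_trans le1 _; rewrite leq_add2r.
apply: leq_trans le.
(* Away from [u] and [v] the glued graph agrees with [G1] and has no edge to the other side, so the
   factor restricts to one of [G1]. *)
have r1 : rho G1 <= #|[set f (inl z) | z in V1]|.
  apply: (@rho_restrict _ _ glue G1 inl [set u; v]) => //.
  - by move=> ? ? [].
  - move=> a b; rewrite !inE adj_build /= => /norP[/negPf-> /negPf->] _.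
    by rewrite andbT.
  - move=> a [z|z]; first by move=> _ _; apply: codom_f.
    rewrite adj_build !inE /=. by move=> /norP[/negPf-> /negPf->].
  - by move=> d; rewrite !inE => /orP[] /eqP->; rewrite k4 // k3 // k2.
have r2 : rho G2 <= #|[set f (inr z) | z in V2]|.
  apply: (@rho_restrict _ _ glue G2 inr [set x; y]) => //.
  - by move=> ? ? [].
  - move=> a b; rewrite !inE adj_build /= => /norP[/negPf-> /negPf->] _.
    by rewrite andbT.
  - move=> a [z|z]; last by move=> _ _; apply: codom_f.
    by rewrite adj_build !inE /= => /norP[/negPf-> /negPf->]; rewrite !andbF.
  - by move=> d; rewrite !inE => /orP[] /eqP-> //; rewrite k4.
apply: leq_trans (leq_add r1 r2) _; rewrite -cardsUI.
suff -> : [set f (inl z) | z in V1] :&: [set f (inr z) | z in V2] = set0.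
  rewrite cards0 addn0; apply/subset_leq_card/fintype.subsetP => S.
  by rewrite inE => /orP[] /imsetP[z _ ->]; rewrite imset_f.
(* A block meeting both sides would cross one of the two new edges, whose ends
   are isolated. *)
apply/setP => S; rewrite !inE; apply/andP => -[/imsetP[a _ ->] /imsetP[b _ eab]].
have [fz fyz fpath] := p.
have /is_induced_pathP[t tp ft] := fpath (inl a).
have at_ : inl a \in t by have := fz (inl a); rewrite ft inE.
have bt : inr b \in t by have := fz (inr b); rewrite -eab ft inE.
have cross c d : inl c \in t -> inr d \in t -> adj glue (inl c) (inr d) -> False.
  move=> ct dt; have cS : inl c \in f (inl a) by rewrite ft inE.
  have dS : inr d \in f (inl a) by rewrite ft inE.
  rewrite -(fyz _ _ cS) in dS; rewrite adj_build /= => /orP[] /andP[/eqP ec _].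
    by move: dS; rewrite ec k4 ?k3 ?k2 // inE.
  by move: dS; rewrite ec k4 ?k3 // inE.
pose P (q : V1 + V2) := if q is inl _ then true else false.
have cst : {in t &, forall q r, P q = P r}.
  case: t tp {ft at_ bt} cross => // q t tp cross.
  suff h : {in q :: t, forall r, P r = P q} by move=> r s /h-> /h->.
  apply: (path_const (induced_path_path tp)) => -[c|c] [d|d] ct dt //= cd.
    by case: (cross c d).
  by case: (cross d c) => //; rewrite adj_sym.
by have := cst _ _ at_ bt.
Qed.

End Glue.

(** Two extremal graphs are glued along one edge of each; positivity of [k] and of the orders
    provides these edges. The 12 is the cost of isolating four ends. *)
Lemma max_rho_superadd k n1 n2 : ~~ odd k -> 0 < k -> 0 < n1 -> 0 < n2 ->
    (exists G : sgraph 'I_n1, connected_regular k G) ->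
    (exists G : sgraph 'I_n2, connected_regular k G) ->
  max_rho k n1 + max_rho k n2 <= max_rho k (n1 + n2) + 12 /\
  exists G : sgraph 'I_(n1 + n2), connected_regular k G.
Proof.
move=> evk k0 n10 n20 /max_rho_witness[G1 /andP[con1 reg1] <-].
move=> /max_rho_witness[G2 /andP[con2 reg2] <-].
have edge n (G : sgraph 'I_n) : 0 < n -> regular G k -> exists u v, adj G u v.
  move=> n0 /regularP/(_ (Ordinal n0)) e; exists (Ordinal n0).
  have [v nuv|no] := pickP (adj G (Ordinal n0)); first by exists v.
  by move: k0; rewrite -e big1 // => v _; rewrite no.
have [u [v uv]] := edge _ G1 n10 reg1; have [x [y xy]] := edge _ G2 n20 reg2.
have card : #|{: 'I_n1 + 'I_n2}| = n1 + n2 by rewrite card_sum !card_ord.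
have [le ex] := rho_le_max_rho card (glue_connected uv xy evk reg1 reg2 con1 con2)
  (glue_regular uv xy reg1 reg2).
by split=> //; apply: leq_trans (rho_glue _ _ u v x y) _; rewrite leq_add2r.
Qed.

(** * Suns with pendants *)

(** A path has at most one vertex more than edges, so summing over the blocks bounds their number
    below by vertices minus edges used. Everything is doubled because the sum ranges over ordered
    pairs. *)
Lemma path_blocks_edges (V : finType) (G : sgraph V) f : path_blocks G f ->
  2 * #|V| <= (\sum_x \sum_y (adj G x y && (f x == f y))) +
              2 * #|[set f z | z in V]|.
Proof.
move=> [fz fyz fpath].
have fE z x : (f x == f z) = (x \in f z).
  by apply/eqP/idP => [<-//|/fyz].
have part F : \sum_x F x =
    \sum_(S in [set f z | z in V]) \sum_(x in S) F x.
  rewrite (partition_big f (mem [set f z | z in V])) => [|x _]; last exact: imset_f.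
  by apply: eq_bigr => S /imsetP[z _ ->]; apply: eq_bigl => x; rewrite fE.
rewrite -cardsT -sum1_card (eq_bigl xpredT) => [|x]; last by rewrite inE.
rewrite !part -sum1_card !big_distrr -big_split /=.
apply: leq_sum => S /imsetP[z _ ->]; rewrite muln1 sum1_card.
apply: leq_trans (induced_path_edges (fpath z)) _; rewrite leq_add2r.
apply: leq_sum => x xz; rewrite [leqLHS]big_mkcond; apply: leq_sum => y _.
by rewrite (fyz _ _ xz) eq_sym fE; case: (y \in f z); rewrite ?andbT.
Qed.

Lemma path_blocks_triangle_free (V : finType) (G : sgraph V) f x y z :
    path_blocks G f -> adj G x y -> adj G y z -> adj G x z ->
  f x = f y -> f y = f z -> False.
Proof.
move=> [fz _ fpath] xy yz xz exy eyz.
apply: (induced_path_triangle_free (fpath z) _ _ _ xy yz xz) => //.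
- by rewrite -eyz -exy.
- by rewrite -eyz.
Qed.

Lemma path_blocks_C4_free (V : finType) (G : sgraph V) f x y z t :
    path_blocks G f -> adj G x y -> adj G y z -> adj G z t -> adj G t x ->
  f x = f y -> f y = f z -> f z = f t -> x = z \/ y = t.
Proof.
move=> [fz _ fpath] xy yz zt tx exy eyz ezt.
apply: (induced_path_C4_free (fpath t) _ _ _ _ xy yz zt tx) => //.
- by rewrite -ezt -eyz -exy.
- by rewrite -ezt -eyz.
- by rewrite -ezt.
Qed.

Lemma sum_eq_andb (T : finType) (a : T) (P : pred T) :
  \sum_x ((a == x) && P x) = P a.
Proof.
rewrite (bigD1 a) //= eqxx big1 ?addn0 // => x.
by rewrite eq_sym => /negPf->.
Qed.

Lemma sum_eq_orb (T : finType) (a b : T) (P : pred T) : a != b ->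
  \sum_x (((x == a) || (x == b)) && P x) = P a + P b.
Proof.
move=> ab; rewrite (bigD1 a) //= eqxx (bigD1 b) 1?eq_sym //= eqxx orbT.
by rewrite big1 ?addn0 // => x /andP[/negPf-> /negPf->].
Qed.

(* [w], [u], [v], [g i] are the blocks met by a pendant and its centre. Since
   the clique of the [g i] has odd order, some [i] is left unmatched. *)
Lemma pendant_count s (T : eqType) (w u v : T) (g : 'I_s.*2.+1 -> T) :
    (forall i j, i != j -> g i = g j -> g i <> u /\ g i <> v) ->
    (forall i j l, i != j -> j != l -> i != l -> g i = g j -> g j = g l -> False) ->
    (forall i, w = u -> u = v -> v = g i -> False) ->
  2 * ((w == u) + (w == v)) + 2 * (\sum_i ((u == g i) + (v == g i))) +
  \sum_i \sum_j ((i != j) && (g i == g j)) <= s.*2 + 4.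
Proof.
move=> tri1 tri2 c4.
pose a i := \sum_j ((i != j) && (g i == g j)).
(* Three clique vertices never share a block, so sharing a block is a matching and [a i] tells
   whether [i] is matched. *)
have a_le1 i : a i <= 1.
  rewrite /a; have [j /andP[nij /eqP eij]|no] := pickP (fun j => (i != j) && (g i == g j)).
    rewrite (bigD1 j) //= nij eij eqxx big1 // => l nlj.
    apply/eqP; rewrite eqb0; apply/negP => /andP[nil /eqP eil].
    by apply: (tri2 i j l); rewrite // eq_sym.
  by rewrite big1 // => j _; rewrite no.
have even : ~~ odd (\sum_i a i).
  apply: (handshake (r := fun i j => (i != j) && (g i == g j))) => [i j|i].
    by rewrite eq_sym [g i == _]eq_sym.
  by rewrite eqxx.
have tot : \sum_i a i + \sum_i (a i == 0) = s.*2.+1.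
  rewrite -big_split /= -[RHS]card_ord -sum1_card; apply: eq_bigr => i _.
  by case: (a i) (a_le1 i) => [|[|]].
(* An end [t] shares its block with at most one clique vertex, and such a vertex is unmatched. *)
have sum_le t : (forall i j, i != j -> g i = g j -> g i <> t) ->
    \sum_i (t == g i) = 0 \/ (\sum_i (t == g i) = 1 /\ exists2 i, t = g i & a i = 0).
  move=> ht; have [i /eqP ei|no] := pickP (fun i => t == g i); last first.
    by left; rewrite big1 // => i _; rewrite no.
  right; split.
    rewrite (bigD1 i) //= {1}ei eqxx big1 // => j; rewrite eq_sym => nij.
    apply/eqP; rewrite eqb0; apply/eqP => ej.
    by apply: (ht i j nij); rewrite -ei.
  exists i => //; rewrite /a big1 // => j _; apply/eqP; rewrite eqb0.
  by apply/negP => /andP[nij /eqP eij]; apply: (ht i j).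
have bw t : (w == t) <= 1 by case: eqP.
have odd_tot : odd (\sum_i a i + \sum_i (a i == 0)) by rewrite tot /= odd_double.
rewrite big_split /= -[X in _ + X <= _]/(\sum_i a i).
have sum_u := sum_le u (fun i j nij eij => (tri1 i j nij eij).1).
have sum_v := sum_le v (fun i j nij eij => (tri1 i j nij eij).2).
case: sum_u => [->|[-> [i ei ai]]].
  case: sum_v => [->|[-> [j ej _]]].
    by have := bw u; have := bw v; lia.
  have : (w == u) + (w == v) <= 1.
    case: eqP => // wu; case: eqP => // wv; case: (c4 j) => //; congruence.
  lia.
case: sum_v => [->|[-> [j ej aj]]].
  have : (w == u) + (w == v) <= 1.
    case: eqP => // wu; case: eqP => // wv; case: (c4 i) => //; congruence.
  lia.
(* If both ends meet the same clique vertex, the 4-cycle excludes both edges at the centre;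
   otherwise two clique vertices are unmatched, hence three by parity. *)
have [eij|nij] := eqVneq i j.
  have [wu wv] : (w == u) = false /\ (w == v) = false.
    by split; apply/eqP => e; case: (c4 i); congruence.
  by rewrite wu wv; lia.
have : (w == u) + (w == v) <= 1.
  case: eqP => // wu; case: eqP => // wv.
  by have [] := tri1 i j nij _; congruence.
have : 2 <= \sum_i (a i == 0).
  by rewrite (bigD1 i) //= ai (bigD1 j) 1?eq_sym //= aj.
lia.
Qed.

(** * Attaching pendants to a core graph *)

Section Pendants.

(* At each [b : B] a copy of [K_{2s+3}] minus an edge is attached to the vertex
   [att b] by the two ends [inl true], [inl false] of the missing edge. *)
Variables (C B : finType) (H : sgraph C) (att : B -> C) (s : nat).

Let V : finType := (C + B * (bool + 'I_s.*2.+1))%type.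

(** The vertices [inr (b, inr i)] form a clique joined to both ends of the copy [b]. The last case
    keeps the two ends apart and joins no core vertex to a clique vertex. *)
Definition pendant_rel (p q : V) : bool :=
  match p, q with
  | inl c, inl c' => adj H c c'
  | inl c, inr (b, inl _) | inr (b, inl _), inl c => att b == c
  | inr (b, inr i), inr (b', inr j) => (b == b') && (i != j)
  | inr (b, inr _), inr (b', inl _) | inr (b, inl _), inr (b', inr _) => b == b'
  | _, _ => false
  end.

Fact pendant_sym : symmetric pendant_rel.
Proof.
move=> [c|[b [x|i]]] [c'|[b' [x'|i']]] //=; first by rewrite adj_sym.
by rewrite eq_sym [i == _]eq_sym.
Qed.

Fact pendant_irr : irreflexive pendant_rel.
Proof. by move=> [c|[b [x|i]]] //=; rewrite ?adj_irr ?eqxx. Qed.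

Definition pendants : sgraph V := build_graph pendant_sym pendant_irr.

Lemma sum_pendants (F : V -> nat) : \sum_p F p = \sum_c F (inl c) +
  \sum_b (F (inr (b, inl true)) + F (inr (b, inl false)) +
          \sum_i F (inr (b, inr i))).
Proof.
rewrite big_sumType /=; congr (_ + _).
rewrite [RHS](eq_bigr (fun b => \sum_z F (inr (b, z)))).
  by rewrite pair_bigA /=; apply: eq_bigr => -[].
by move=> b _; rewrite big_sumType /= big_bool.
Qed.

Lemma card_pendants : #|V| = #|C| + #|B| * s.*2.+3.
Proof. by rewrite card_sum card_prod card_sum card_bool card_ord. Qed.

(** Each copy adds two to the degree of its centre, and an end gets the centre in place of the
    neighbour lost with the missing edge. *)
Lemma pendants_regular :
    (forall c, \sum_c' adj H c c' + 2 * (\sum_b (att b == c)) = s.*2.+2) ->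
  regular pendants s.*2.+2.
Proof.
move=> deg; apply/regularP => p; under eq_bigr do rewrite adj_build.
rewrite sum_pendants; case: p => [c|[b [x|i]]] /=.
- rewrite -(deg c) big_distrr; congr (_ + _); apply: eq_bigr => b _ /=.
  by rewrite big1 // addn0 mul2n -addnn.
- have -> : \sum_c (att b == c) = 1.
    by rewrite -[RHS](sum_eq_andb (att b) predT); apply: eq_bigr => c; rewrite andbT.
  under eq_bigr do rewrite add0n sum_nat_const card_ord.
  rewrite (bigD1 b) //= eqxx big1 ?addn0 ?muln1 // => b'.
  by rewrite eq_sym => /negPf->; rewrite muln0.
- rewrite big1 // add0n (bigD1 b) //= eqxx [X in _ + X]big1 ?addn0; last first.
    by move=> b'; rewrite eq_sym => /negPf->; rewrite big1.
  rewrite /= (eq_bigr (fun j => 1 - (i == j))); last by move=> j _; case: eqP.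
  rewrite sumnB; last by move=> j _; case: eqP.
  rewrite sum1_card card_ord.
  have -> : \sum_j (i == j) = 1.
    by rewrite -[RHS](sum_eq_andb i predT); apply: eq_bigr => j; rewrite andbT.
  by rewrite subn1 /= add2n.
Qed.

Lemma pendants_connected : connected_graph H -> connected_graph pendants.
Proof.
move=> conH.
have cH c c' : connect (adj pendants) (inl c) (inl c').
  have /forallP/(_ c)/forallP/(_ c')/connectP[p pp ->] := conH.
  apply/connectP; exists (map inl p); last by rewrite last_map.
  by rewrite path_map; apply: sub_path pp => x y /=; rewrite adj_build.
have cB b z : connect (adj pendants) (inr (b, z)) (inl (att b)).
  have h x : connect (adj pendants) (inr (b, inl x)) (inl (att b)).
    by apply: connect1; rewrite adj_build /=.
  case: z => [x|i]; first exact: h.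
  by apply: connect_trans _ (h true); apply: connect1; rewrite adj_build /=.
apply/forallP => -[c|[b z]]; apply/forallP => -[c'|[b' z']] //.
- by rewrite connect_graph_sym; apply: connect_trans (cB _ _) (cH _ _).
- exact: connect_trans (cB _ _) (cH _ _).
- apply: connect_trans (cB _ _) _; rewrite connect_graph_sym.
  exact: connect_trans (cB _ _) (cH _ _).
Qed.

(** A factor uses at most [E] edges of the core and [s + 2] at each pendant, against [2s + 3]
    vertices per pendant. In the core only the absence of a triangle inside a block is exploited,
    hence the hypothesis on colourings [col]. *)
Lemma pendants_rho E :
    (forall (T : eqType) (col : C -> T),
      (forall x y z, adj H x y -> adj H y z -> adj H x z ->
        col x = col y -> col y = col z -> False) ->
      \sum_x \sum_y (adj H x y && (col x == col y)) <= 2 * E) ->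
  #|C| + #|B| * s.+1 <= rho pendants + E.
Proof.
move=> coreE; have [f fp le] := rho_blocks pendants.
have := path_blocks_edges fp.
rewrite card_pendants sum_pendants.
have row1 : \sum_c \sum_q (adj pendants (inl c) q && (f (inl c) == f q)) =
    \sum_c \sum_c' (adj H c c' && (f (inl c) == f (inl c'))) +
    \sum_b ((f (inl (att b)) == f (inr (b, inl true))) +
            (f (inl (att b)) == f (inr (b, inl false)))).
  have -> : \sum_b ((f (inl (att b)) == f (inr (b, inl true))) +
            (f (inl (att b)) == f (inr (b, inl false)))) =
      \sum_c \sum_b ((att b == c) && (f (inl c) == f (inr (b, inl true))) +
                     (att b == c) && (f (inl c) == f (inr (b, inl false)))).
    rewrite exchange_big; apply: eq_bigr => b _ /=.
    by rewrite big_split /= !(sum_eq_andb (att b) (fun c => f (inl c) == _)).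
  rewrite -big_split; apply: eq_bigr => c _ /=; rewrite sum_pendants.
  congr (_ + _); first by apply: eq_bigr => c' _; rewrite adj_build.
  apply: eq_bigr => b _; rewrite !adj_build /= big1 ?addn0 // => i _.
  by rewrite adj_build.
have row2 b x : \sum_q (adj pendants (inr (b, inl x)) q && (f (inr (b, inl x)) == f q)) =
    (f (inl (att b)) == f (inr (b, inl x))) +
    \sum_i (f (inr (b, inl x)) == f (inr (b, inr i))).
  rewrite sum_pendants; congr (_ + _).
    under eq_bigr do rewrite adj_build /= eq_sym [f _ == _]eq_sym.
    under eq_bigr do rewrite [_ == att b]eq_sym.
    by rewrite (sum_eq_andb (att b) (fun c => f (inl c) == _)).
  rewrite (bigD1 b) //= !adj_build /= [X in _ + X]big1 ?addn0 ?add0n.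
    by apply: eq_bigr => i _; rewrite adj_build /= eqxx.
  move=> b'; rewrite eq_sym => /negPf nb; rewrite !adj_build /= big1 // => i _.
  by rewrite adj_build /= nb.
have row3 b i : \sum_q (adj pendants (inr (b, inr i)) q && (f (inr (b, inr i)) == f q)) =
    (f (inr (b, inl true)) == f (inr (b, inr i))) +
    (f (inr (b, inl false)) == f (inr (b, inr i))) +
    \sum_j ((i != j) && (f (inr (b, inr i)) == f (inr (b, inr j)))).
  rewrite sum_pendants big1 ?add0n; last by move=> c _; rewrite adj_build.
  rewrite (bigD1 b) //= !adj_build /= eqxx [X in _ + X]big1 ?addn0; last first.
    move=> b'; rewrite eq_sym => /negPf nb; rewrite !adj_build /= nb big1 // => j _.
    by rewrite adj_build /= nb.
  congr (_ + _ + _); rewrite 1?eq_sym //.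
  by apply: eq_bigr => j _; rewrite adj_build /= eqxx.
have core : \sum_c \sum_c' (adj H c c' && (f (inl c) == f (inl c'))) <= 2 * E.
  apply: coreE => x y z xy yz xz.
  by apply: (path_blocks_triangle_free fp); rewrite adj_build.
have pend : \sum_b ((f (inl (att b)) == f (inr (b, inl true))) +
            (f (inl (att b)) == f (inr (b, inl false)))) +
    \sum_b (\sum_q (adj pendants (inr (b, inl true)) q && (f (inr (b, inl true)) == f q))
    + \sum_q (adj pendants (inr (b, inl false)) q && (f (inr (b, inl false)) == f q))
    + \sum_i \sum_q (adj pendants (inr (b, inr i)) q && (f (inr (b, inr i)) == f q)))
    <= #|B| * (s.*2 + 4).
  rewrite -big_split -sum_nat_const; apply: leq_sum => b _ /=.
  rewrite !row2; rewrite (eq_bigr _ (fun i _ => row3 b i)).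
  have tri x i j : i != j -> f (inr (b, inr i)) = f (inr (b, inr j)) ->
      f (inr (b, inr i)) <> f (inr (b, inl x)).
    move=> nij eij e; apply: (path_blocks_triangle_free fp) (esym eij) e;
      by rewrite adj_build /= ?eqxx ?nij // eq_sym.
  have := @pendant_count s _ (f (inl (att b))) (f (inr (b, inl true)))
    (f (inr (b, inl false))) (fun i => f (inr (b, inr i))).
  rewrite !big_split /= => cnt; apply: leq_trans (cnt _ _ _) => {cnt}; first by lia.
  - by move=> i j nij eij; split; apply: tri nij eij.
  - move=> i j l nij njl nil; apply: (path_blocks_triangle_free fp);
      by rewrite adj_build /= eqxx ?nij ?njl ?nil.
  - move=> i ewu euv evi.
    (* The centre, one end, a clique vertex and the other end form a 4-cycle. *)
    have [] // := path_blocks_C4_free (x := inl (att b)) (y := inr (b, inl true))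
      (z := inr (b, inr i)) (t := inr (b, inl false)) fp _ _ _ _ ewu
      (etrans euv evi) (esym evi); by rewrite adj_build /= eqxx.
rewrite row1 => edges; lia.
Qed.

End Pendants.

(** * The sun *)

Section Sun.

Variable m : nat.

Let I : finType := 'I_m.+3.
Let C : finType := (I * bool)%type.

Lemma ordS_neq (i : I) : i != ordS i.
Proof.
rewrite -val_eqE /= neq_ltn; case: i => i /=.
rewrite ltnS leq_eqVlt => /predU1P[->|lt]; first by rewrite modnn orbT.
by rewrite modn_small // ltnSn.
Qed.

(** The cycle has length at least three, so the two cycle neighbours of a vertex are distinct. *)
Lemma ordSS_neq (i : I) : i != ordS (ordS i).
Proof.
rewrite -val_eqE /=; case: i => i /=; rewrite ltnS => le.
have [lt|ge] := ltnP i.+2 m.+3; first by rewrite !modn_small; lia.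
have [->|->] : i = m.+1 \/ i = m.+2 by lia.
  by rewrite (modn_small (ltnSn _)) modnn.
by rewrite modnn modn_small.
Qed.

(* The vertices [(i, true)] form a cycle, and [(i, false)] is joined to its
   [i]-th edge. *)
Definition sun_rel (p q : C) : bool :=
  match p, q with
  | (i, true), (j, true) => (j == ordS i) || (i == ordS j)
  | (i, false), (j, true) | (j, true), (i, false) => (j == i) || (j == ordS i)
  | (_, false), (_, false) => false
  end.

Fact sun_sym : symmetric sun_rel.
Proof. by move=> [i []] [j []] //=; rewrite orbC. Qed.

Fact sun_irr : irreflexive sun_rel.
Proof. by move=> [i []] //=; rewrite (negPf (ordS_neq i)). Qed.

Definition sun : sgraph C := build_graph sun_sym sun_irr.

Lemma sum_sun (F : C -> nat) :
  \sum_c F c = \sum_i (F (i, true) + F (i, false)).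
Proof.
rewrite [RHS](eq_bigr (fun i => \sum_b F (i, b))) => [|i _]; last by rewrite big_bool.
by rewrite pair_bigA /=; apply: eq_bigr => -[].
Qed.

Lemma sun_connected : connected_graph sun.
Proof.
pose o : I := ord0.
have c1 n : connect (adj sun) (o, true) (iter n (@ordS _) o, true).
  elim: n => [|n IH]; first exact: connect0.
  by apply: connect_trans IH (connect1 _); rewrite adj_build /= eqxx.
have c2 (i : I) : connect (adj sun) (o, true) (i, true).
  suff -> : i = iter i (@ordS _) o by [].
  apply: val_inj; rewrite /=; case: i => n /=; elim: n => //= n IH lt.
  by rewrite -IH ?modn_small // ltnW.
have c3 p : connect (adj sun) (o, true) p.
  case: p => i [//|]; apply: connect_trans (c2 i) (connect1 _).
  by rewrite adj_build /= eqxx.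
apply/forallP => p; apply/forallP => q.
by apply: connect_trans _ (c3 q); rewrite connect_graph_sym.
Qed.

Let ordS_swap (i j : I) : (i == ordS j) = (j == ord_pred i).
Proof. by apply/eqP/eqP => ->; rewrite ?ordSK ?ord_predK. Qed.

Let ord_pred_neq (i : I) : i != ord_pred i.
Proof. by rewrite -{1}[i]ord_predK eq_sym ordS_neq. Qed.

Let ordS_pred_neq (i : I) : ordS i != ord_pred i.
Proof. by rewrite -ordS_swap ordSS_neq. Qed.

Let sum2 (a b : I) : a != b -> \sum_x ((x == a) || (x == b)) = 2.
Proof.
move=> /(sum_eq_orb predT) /= e; rewrite -[RHS]e.
by apply: eq_bigr => x _; rewrite andbT.
Qed.

Lemma sun_degree c : \sum_c' adj sun c c' = if c.2 then 4 else 2.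
Proof.
under eq_bigr do rewrite adj_build.
rewrite sum_sun; case: c => i [] /=; last first.
  by under eq_bigr do rewrite addn0; rewrite sum2 ?ordS_neq.
rewrite big_split /=; under eq_bigr do rewrite (ordS_swap i); rewrite sum2 //.
by under eq_bigr do rewrite eq_sym (ordS_swap i); rewrite sum2.
Qed.

(** The edges split into the [m + 3] triangles on [(i, false)], [(i, true)], [(ordS i, true)], and
    two monochromatic edges of a triangle would make all of it monochromatic. *)
Lemma sun_edges (T : eqType) (col : C -> T) :
    (forall x y z, adj sun x y -> adj sun y z -> adj sun x z ->
      col x = col y -> col y = col z -> False) ->
  \sum_x \sum_y (adj sun x y && (col x == col y)) <= 2 * m.+3.
Proof.
move=> tri; rewrite sum_sun.
have row1 i : \sum_y (adj sun (i, false) y && (col (i, false) == col y)) =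
    (col (i, false) == col (i, true)) + (col (i, false) == col (ordS i, true)).
  rewrite sum_sun -(sum_eq_orb (fun j => col (i, false) == col (j, true))).
    by apply: eq_bigr => j _; rewrite !adj_build /= addn0.
  exact: ordS_neq.
have row2 : \sum_i \sum_y (adj sun (i, true) y && (col (i, true) == col y)) =
    2 * (\sum_i (col (i, true) == col (ordS i, true))) +
    \sum_i ((col (i, false) == col (i, true)) + (col (i, false) == col (ordS i, true))).
  rewrite (eq_bigr _ (fun i _ => sum_sun _)).
  under eq_bigr do rewrite big_split; rewrite big_split /=; congr (_ + _).
    rewrite (eq_bigr (fun i => (col (i, true) == col (ordS i, true)) +
       (col (i, true) == col (ord_pred i, true)))) => [|i _]; last first.
      rewrite -(sum_eq_orb (fun j => col (i, true) == col (j, true))) //.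
      by apply: eq_bigr => j _; rewrite adj_build /= (ordS_swap i).
    rewrite big_split mul2n -addnn; congr (_ + _).
    rewrite (reindex_inj (can_inj (@ordSK _))) /=; apply: eq_bigr => i _.
    by rewrite ordSK eq_sym.
  rewrite exchange_big; apply: eq_bigr => i _.
  rewrite -(sum_eq_orb (fun j => col (i, false) == col (j, true))) ?ordS_neq //.
  by apply: eq_bigr => j _; rewrite adj_build /= [col _ == _]eq_sym.
rewrite big_split /= row2 (eq_bigr _ (fun i _ => row1 i)).
apply: (@leq_trans (2 * \sum_(i < m.+3) 1)); last by rewrite sum1_card card_ord.
rewrite -addnA addnn -mul2n -mulnDr leq_mul2l /=.
rewrite -big_split; apply: leq_sum => i _ /=.
have h1 : adj sun (i, true) (ordS i, true) by rewrite adj_build /= eqxx.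
have h2 : adj sun (i, false) (i, true) by rewrite adj_build /= eqxx.
have h3 : adj sun (i, false) (ordS i, true) by rewrite adj_build /= eqxx orbT.
have t := tri _ _ _ h2 h1 h3.
case: eqP => e1; case: eqP => e2; case: eqP => e3 //; case: t; congruence.
Qed.

End Sun.

(** For each [i] there are two core vertices, one triangle and [2r + 1] pendants of [2r + 5]
    vertices; [pendants_rho] applies with [s = r + 1] and [E = m + 3]. *)
Lemma max_rho_sun r m (k := r.*2 + 4)
    (n := m.+3 * (2 + (r.*2 + 1) * (r.*2 + 5))) :
  m.+3 * (1 + (r.*2 + 1) * (r + 2)) <= max_rho k n /\
  exists G : sgraph 'I_n, connected_regular k G.
Proof.
(* Each cycle vertex, of degree 4, receives [r] pendants and each other core vertex, of degree 2,
   receives [r + 1]; all degrees become [2r + 4]. *)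
pose att (b : 'I_m.+3 * ('I_r + 'I_r.+1)) : 'I_m.+3 * bool :=
  (b.1, if b.2 is inl _ then true else false).
pose G := pendants (sun m) att r.+1.
have cardB : #|{: 'I_m.+3 * ('I_r + 'I_r.+1)}| = m.+3 * (r.*2 + 1).
  by rewrite card_prod card_sum !card_ord; lia.
have cardC : #|{: 'I_m.+3 * bool}| = m.+3 * 2 by rewrite card_prod card_bool card_ord.
have ke : k = r.+1.*2.+2 by rewrite /k; lia.
have card : #|{: 'I_m.+3 * bool + 'I_m.+3 * ('I_r + 'I_r.+1) *
    (bool + 'I_r.+1.*2.+1)}| = n.
  by rewrite card_pendants cardB cardC /n; lia.
have reg : regular G k.
  rewrite ke; apply: pendants_regular => -[i x]; rewrite sun_degree /=.
  have -> : \sum_b (att b == (i, x)) = if x then r else r.+1.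
    rewrite -(pair_bigA _ (fun j z => (att (j, z) == (i, x)) : nat)) /=.
    rewrite (bigD1 i) //= [X in _ + X]big1 ?addn0 => [|j /negPf ji]; last first.
      by rewrite big1 // => z _; rewrite xpair_eqE /= ji.
    rewrite big_sumType /=.
    under eq_bigr do rewrite xpair_eqE eqxx; rewrite sum_nat_const card_ord.
    under eq_bigr do rewrite xpair_eqE eqxx; rewrite sum_nat_const card_ord.
    by case: x => /=; lia.
  by case: x; lia.
have [le ex] := rho_le_max_rho card (pendants_connected att r.+1 (sun_connected m)) reg.
split=> //; apply: leq_trans le.
have := pendants_rho att r.+1 (@sun_edges m); rewrite cardB cardC -/G.
by move: (rho G) => N; lia.
Qed.

(** * Fekete's lemma and the limit *)

Import Order.TTheory GRing.Theory Num.Theory.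
Import numFieldNormedType.Exports.
Local Open Scope classical_set_scope.
Local Open Scope ring_scope.

Section Fekete.

Variables (R : realType) (S : set nat) (a : nat -> R).
Hypothesis addS : forall m n, (0 < m)%N -> (0 < n)%N -> S m -> S n -> S (m + n)%N.
Hypothesis adda : forall m n, (0 < m)%N -> (0 < n)%N -> S m -> S n ->
  a m + a n <= a (m + n)%N.
Hypothesis a_le : forall n, S n -> a n <= n%:R.
Hypothesis unboundedS : forall N, exists2 n, (N < n)%N & S n.

Let E : set R := [set a n / n%:R | n in [set n | S n /\ (0 < n)%N]].

Let supE : has_sup E.
Proof.
split; first by have [n n0 Sn] := unboundedS 0; exists (a n / n%:R), n.
exists 1 => _ [n [Sn n0] <-]; rewrite ler_pdivrMr ?ltr0n // mul1r; exact: a_le.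
Qed.

Lemma fekete_ub n : S n -> (0 < n)%N -> a n / n%:R <= sup E.
Proof. by move=> Sn n0; apply: (sup_upper_bound supE); exists n. Qed.

Let a_mul m t q : (0 < m)%N -> (0 < t)%N -> S m -> S t ->
  S (t + q * m)%N /\ a t + q%:R * a m <= a (t + q * m)%N.
Proof.
move=> m0 t0 Sm St; elim: q => [|q [IHS IH]].
  by rewrite mul0n addn0 mul0r addr0.
have tq0 : (0 < t + q * m)%N by rewrite addn_gt0 t0.
rewrite mulSn [(m + _)%N]addnC addnA; split; first exact: addS.
apply: le_trans (adda _ _ _ _) => //.
by rewrite -natr1 mulrDl mul1r addrA lerD2r.
Qed.

(* Along each residue class mod [m], [a] grows at least with slope [a m / m]. *)
Lemma fekete : a n / n%:R @[n --> within S \oo] --> sup E.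
Proof.
apply/cvgrPdist_le => e e0.
have e20 : 0 < e / 2 by rewrite divr_gt0.
(* [m] has a ratio within [e / 2] of the supremum; the other half of [e] absorbs the error of each
   residue class. *)
have [_ [m [Sm m0] <-] lt_b] := sup_adherent e20 supE.
set b := a m / m%:R in lt_b.
have mR : m%:R != 0 :> R by rewrite pnatr_eq0 -lt0n.
have res (r : 'I_m) : exists N, forall n, (N <= n)%N -> S n -> (n %% m = r)%N ->
    (0 < n)%N /\ sup E - e <= a n / n%:R.
  have [[t [St t0 tr]]|no] := pselect (exists t, [/\ S t, (0 < t)%N & (t %% m = r)%N]);
    last first.
    by exists 1%N => n n1 Sn nr; case: no; exists n.
  (* Adding multiples of [m] to [t] gives [a n >= n b - d], and [d] is at most [e n / 2] for large
     [n]. *)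
  pose d := `|a t - t%:R * b|.
  exists (maxn t (Num.bound (d / (e / 2)))) => n.
  rewrite geq_max => /andP[tn dn] Sn nr.
  have n0 : (0 < n)%N by exact: leq_trans t0 tn.
  have nR : 0 < n%:R :> R by rewrite ltr0n.
  split=> //.
  have [q nE] : exists q, n = (t + q * m)%N.
    exists ((n - t) %/ m)%N; rewrite divnK ?subnKC //.
    by rewrite -eqn_mod_dvd // nr tr.
  have [_] := a_mul q m0 t0 Sm St; rewrite -nE => le_an.
  have dle : d <= e / 2 * n%:R.
    have d0 : 0 <= d / (e / 2) by rewrite divr_ge0 ?normr_ge0 // ltW.
    rewrite mulrC -ler_pdivrMr //; apply: le_trans (ltW (archi_boundP d0)) _.
    by rewrite ler_nat.
  rewrite ler_pdivlMr //; apply: le_trans le_an.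
  have -> : q%:R * a m = (n%:R - t%:R) * b.
    by rewrite nE natrD natrM /b; field.
  have := ler_norm (- (a t - t%:R * b)); rewrite normrN -/d => le_d.
  have : (sup E - e / 2) * n%:R <= b * n%:R by rewrite ler_pM2r // ltW.
  move: le_d dle; rewrite !mulrBl; lra.
(* There are finitely many residue classes, so the largest of their thresholds serves them all. *)
have [N hN] := choice res.
exists (\max_i N i).+1 => // n /= Nn Sn.
have [n0 lb] : (0 < n)%N /\ sup E - e <= a n / n%:R.
  apply: (hN (Ordinal (ltn_pmod n m0))) => //.
  by apply: leq_trans (ltnW Nn); apply: leq_bigmax.
have ub := fekete_ub Sn n0.
by rewrite ger0_norm ?subr_ge0 // lerBlDl -lerBlDr.
Qed.

End Fekete.

Lemma natr_div_cvg0 (R : realType) (x : R) : x / n%:R @[n --> \oo] --> 0.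
Proof.
apply/cvgrPdist_le => e e0; have xe0 : 0 <= `|x| / e by rewrite divr_ge0 // ltW.
exists (Num.bound (`|x| / e)).+1 => // n /= xn; rewrite sub0r normrN.
have n0 : 0 < n%:R :> R by rewrite ltr0n (leq_trans _ xn).
rewrite normrM normfV [`|n%:R|]gtr0_norm // ler_pdivrMr // mulrC -ler_pdivrMr //.
by apply: le_trans (ltW (archi_boundP xe0)) _; rewrite ler_nat ltnW.
Qed.

(** * The limit for even degree *)

Section EvenDegree.

Variables (R : realType) (r : nat).

Let k := (r.*2 + 4)%N.
Let S : set nat := [set n | exists G : sgraph 'I_n, connected_regular k G].
(** Subtracting 12 turns superadditivity up to the constant 12 into genuine superadditivity. *)
Let a n : R := (max_rho k n)%:R - 12.
Let evk : ~~ odd k. Proof. by rewrite oddD odd_double. Qed.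
Let k0 : (0 < k)%N. Proof. by rewrite addn_gt0 orbT. Qed.

Let addS m n : (0 < m)%N -> (0 < n)%N -> S m -> S n -> S (m + n)%N.
Proof. by move=> m0 n0 Sm Sn; case: (max_rho_superadd evk k0 m0 n0 Sm Sn). Qed.

Let adda m n : (0 < m)%N -> (0 < n)%N -> S m -> S n -> a m + a n <= a (m + n)%N.
Proof.
move=> m0 n0 Sm Sn; have [+ _] := max_rho_superadd evk k0 m0 n0 Sm Sn.
rewrite -(ler_nat R) !natrD /a; lra.
Qed.

Let a_le n : S n -> a n <= n%:R.
Proof.
move=> _; have : (max_rho k n)%:R <= n%:R :> R by rewrite ler_nat max_rho_le.
by rewrite /a; lra.
Qed.

Let unboundedS N : exists2 n, (N < n)%N & S n.
Proof.
have [_ ex] := max_rho_sun r N; eexists; last exact: ex.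
by rewrite mulnDr; lia.
Qed.

(** By Fekete's lemma the limit is a supremum, so it is at least the ratio of each sun; long suns
    make the 12 negligible. *)
Lemma c_even_ge :
  (1 + (r.*2 + 1) * (r + 2))%N%:R / (2 + (r.*2 + 1) * (r.*2 + 5))%N%:R <= c R k.
Proof.
set p := (1 + _)%N; set q := (2 + _)%N.
set s := sup [set a n / n%:R | n in [set n | S n /\ (0 < n)%N]].
(* The filter is proper because the admissible orders are unbounded; limits along it are then unique
   and [lim] can be evaluated. *)
have PF : ProperFilter (within S \oo).
  split; last exact: within_filter.
  move=> [N _ NS]; have [n Nn Sn] := unboundedS N.
  exact: (NS n (ltnW Nn) Sn).
have -> : c R k = s.
  apply: cvg_lim => //.
  have /cvgD := fekete addS adda a_le unboundedS.
  move=> /(_ (fun n => 12 / n%:R) 0); rewrite addr0.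
  have -> : ((fun n => a n / n%:R) + (fun n => 12 / n%:R) : nat -> R) =
      (fun n => (max_rho k n)%:R / n%:R).
    by apply/funext => n /=; rewrite /GRing.add /= -mulrDl subrK.
  apply; apply: cvg_trans (natr_div_cvg0 (12 : R)).
  by apply: cvg_app; apply: cvg_within.
apply/ler_addgt0Pr => e e0.
(* This [m] makes [12 / (m + 3)] smaller than [e]. *)
pose m := Num.bound (12 / e); have [le_p ex] := max_rho_sun r m.
have q0 : 0 < q%:R :> R by rewrite ltr0n.
have lt_m : 12 < e * m.+3%:R.
  have e12 : 0 <= 12 / e by rewrite divr_ge0 // ltW.
  rewrite mulrC -ltr_pdivrMr //; apply: lt_le_trans (archi_boundP e12) _.
  by rewrite ler_nat; apply/leqW/leqW/leqW.
have nq0 : (0 < m.+3 * q)%N by [].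
have := fekete_ub a_le unboundedS ex nq0.
rewrite -/s ler_pdivrMr ?ltr0n // => le_s.
have : m.+3%:R * p%:R <= (max_rho k (m.+3 * q))%:R :> R by rewrite -natrM ler_nat.
have q1 : 1 <= q%:R :> R by rewrite ler1n.
rewrite ler_pdivrMr //.
move: le_s; rewrite /a natrM => le_s le_m.
have m0 : 0 < m.+3%:R :> R by rewrite ltr0n.
rewrite -(ler_pM2l m0).
have : 12 <= e * m.+3%:R * q%:R.
  by apply: le_trans (ltW lt_m) _; rewrite ler_peMr // mulr_ge0 // ltW.
move=> le12; apply: le_trans le_m _.
have -> : m.+3%:R * ((s + e) * q%:R) =
  s * (m.+3%:R * q%:R) + e * m.+3%:R * q%:R by ring.
by move: le_s; rewrite -/q; lra.
Qed.

End EvenDegree.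

Theorem theorem25 (R : realType) :
  [/\ 3 / 7 <= c R 4,
      forall k : nat, (4 <= k)%N -> ~~ odd k ->
        1 / 2 - 1 / (2 * k%:R - 2) <= c R k
    & (fun k : nat => 1 / 2 - 1 / (2 * k%:R - 2) : R^o) =
        cst (1 / 2) +O_\oo (fun k : nat => k%:R^-1 : R^o)].
Proof.
split.
(* For [r = 0] the density is [(1 + 2) / (2 + 5)]. *)
- by have := c_even_ge R 0; rewrite /= !natrD.
- move=> k k4 evk; have -> : k = ((k./2 - 2).*2 + 4)%N by lia.
  set r := (k./2 - 2)%N.
  apply: le_trans (c_even_ge R r).
  rewrite !natrD !natrM !natrD -muln2 natrM.
  have r0 : 0 <= r%:R :> R by [].
  (* In terms of [r] the target is [(r + 1) / (2r + 3)]; after cross-multiplication the difference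
     is [2(r + 1)]. *)
  have -> : 1 / 2 - 1 / (2 * (r%:R * 2 + 4) - 2) = (r%:R + 1) / (2 * r%:R + 3) :> R.
    by field; rewrite !gt_eqF //; lra.
  rewrite ler_pdivrMr; last by lra.
  rewrite mulrAC ler_pdivlMr; last by nra.
  nra.
(* The error is exactly [1 / (2k - 2)], at most [1 / k] from [k = 2] on, so any [C >= 1] will do. *)
apply/eqaddOP; near=> C; exists 2%N => // k /= k2.
have k2R : 2 <= k%:R :> R by rewrite ler_nat.
rewrite /= !fctE.
have -> : 1 / 2 - 1 / (2 * k%:R - 2) - 1 / 2 = - (2 * k%:R - 2)^-1 :> R by lra.
rewrite normrN !ger0_norm ?invr_ge0 //; last by lra.
apply: (@le_trans _ _ (k%:R^-1)).
  by rewrite lef_pV2 ?posrE; lra.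
by rewrite ler_peMl ?invr_ge0.
Unshelve. all: by end_near.
Qed.
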